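(* Let $(\Omega,\mu)$ be a $\sigma$-finite measure space and $p \in [1,\infty)$. Let $T = (T(t))_{t \ge 0}$ be a positive $C_0$-semigroup on $L^p(\Omega,\mu)$ which is relatively uniformly continuous, and let $f \in L^p(\Omega,\mu)$. Then there exist a representative $\hat f : \Omega \to \mathbb{R}$ of $f$ and a family $(\widehat{T(t)f})_{t \in (0,\infty)}$ of representatives $\widehat{T(t)f} : \Omega \to \mathbb{R}$ of the vectors $T(t)f$ such that $$\lim_{t \downarrow 0} \widehat{T(t)f}(\omega) = \hat f(\omega)$$ for all $\omega \in \Omega$.
   Context: $L^p(\Omega,\mu)$ is the real Banach lattice of almost-everywhere equivalence classes of real-valued measurable $p$-integrable functions, with the almost-everywhere order; a representative of an element is a measurable function $\Omega \to \mathbb{R}$ in that equivalence class. A $C_0$-semigroup on a Banach lattice $E$ is positive if each $T(t)$ maps the positive cone $E_+$ into itself. A positive $C_0$-semigroup $T$ on a Banach lattice $E$ is relatively uniformly continuous if for each $x \in E$ the net $(T(t)x)_{t\in(0,\infty)}$ converges relatively uniformly to $x$ as $t \downarrow 0$, i.e. there exists $u \in E_+$ such that for every $\varepsilon > 0$ there exists $t_0 > 0$ with $|T(t)x - x| \le \varepsilon u$ for all $t \in (0,t_0]$. *)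

(* Defs.v *)
From HB Require Import structures.
From mathcomp Require Import all_boot all_order all_algebra.
From mathcomp Require Import all_classical all_reals all_analysis.
From mathcomp Require Import measurable_realfun ess_sup_inf generic_quotient.

Set Implicit Arguments.
Unset Strict Implicit.
Unset Printing Implicit Defensive.

Import Order.TTheory GRing.Theory Num.Theory.
Import numFieldNormedType.Exports.

Local Open Scope classical_set_scope.
Local Open Scope ring_scope.

Section LspaceQuotient.
Context d (T : measurableType d) (R : realType).
Variable mu : {measure set T -> \bar R}.
Variables (p : \bar R) (p1 : (1 <= p)%E).

Local Notation Lf := (LfunType mu p1).
Local Notation E := (LspaceType mu p1).
Implicit Types (f g : E) (F G : Lf).

Lemma ae_eq_Lnorm (u v : T -> R) :
  measurable_fun [set: T] u -> measurable_fun [set: T] v ->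
  u = v %[ae mu] -> 'N[mu]_p[EFin \o u]%E = 'N[mu]_p[EFin \o v]%E.
Proof.
move=> mu_ mv uv; rewrite unlock; case: p p1 => [r|//|//] r1.
  have mpow (w : T -> R) : measurable_fun [set: T] w ->
      measurable_fun [set: T] (fun x => `|(EFin \o w) x| `^ r)%E.
    move=> mw; apply: (@measurableT_comp _ _ _ _ _ _ (fun x => x `^ r)%E).
      exact: measurable_poweR.
    by apply: measurableT_comp => //; exact/measurable_EFinP.
  congr poweR; apply: ae_eq_integral => //; [exact: mpow..|].
  by apply: filterS uv => x /= h Dx; rewrite h.
case: ifP => // _; apply: eq_ess_sup.
by apply: filterS uv => x /= h; rewrite h.
Qed.

Lemma measurable_Lspace f : measurable_fun [set: T] (f : T -> R).
Proof. exact: (@measurable_funPT _ _ _ _ (repr (LebesgueSpace.sort f))). Qed.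

Fact Lspace_of_subproof (f : {mfun_ mu, T >-> measurableTypeR R}) F :
  (f : T -> R) = F %[ae mu] -> finite_norm mu p f.
Proof.
move=> fF; rewrite /finite_norm (ae_eq_Lnorm _ _ fF)//.
- exact: Lfunction_finite.
- exact: (@measurable_funPT _ _ _ _ (repr f)).
Qed.

Definition Lfun_mfun F : {mfun T >-> measurableTypeR R} :=
  HB.pack (F : T -> measurableTypeR R)
    (@isMeasurableFun.Build _ _ T (measurableTypeR R) F (measurable_funPT F)).

Lemma pi_mfunE (F : {mfun T >-> measurableTypeR R}) :
  (((\pi F)%qT : {mfun_ mu, T >-> measurableTypeR R}) : T -> R) = F %[ae mu].
Proof.
have /eqmodP/asboolP := reprK ((\pi F)%qT : {mfun_ mu, T >-> measurableTypeR R}).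
exact.
Qed.

Definition Lspace_of F : E :=
  LebesgueSpace.Pack (LebesgueSpace.Class
    (@isFinLebesgue.Axioms_ _ _ _ _ _ p1 _
       (Lspace_of_subproof (pi_mfunE (Lfun_mfun F))))).

Lemma Lspace_ofE F : (Lspace_of F : T -> R) = F %[ae mu].
Proof. exact: pi_mfunE. Qed.

Fact Lspace_Lfun_subproof f : (f : T -> R) \in Lfun mu p.
Proof.
apply/andP; split; rewrite inE; first exact: measurable_Lspace.
exact: Lebesgue_finite.
Qed.

Definition Lspace_repr f : Lf := Lfun_Sub p1 (Lspace_Lfun_subproof f).

Lemma Lspace_reprE f : Lspace_repr f = f :> (T -> R).
Proof. by []. Qed.

Lemma LspaceP f g : (f : T -> R) = g %[ae mu] <-> f = g.
Proof.
split=> [fg|->]; last exact: ae_eq_refl.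
have fgE : LebesgueSpace.sort f = LebesgueSpace.sort g.
  rewrite -[LHS]reprK -[RHS]reprK; apply/eqmodP/asboolP; exact: fg.
case: f g fgE {fg} => [f [[cf]]] [g [[cg]]] /= fg.
by move: cg; rewrite -fg => cg; rewrite (Prop_irrelevance cf cg).
Qed.


Fact Lfun_abs_subproof F : (fun x => `|F x|) \in Lfun mu p.
Proof.
apply/andP; split; rewrite inE /=; first exact: measurableT_comp.
rewrite /finite_norm.
rewrite (_ : EFin \o _ = abse \o (EFin \o F)); last exact/funext.
by rewrite Lnorm_abse; exact: Lfunction_finite.
Qed.

Definition Lfun_abs F : Lf := Lfun_Sub p1 (Lfun_abs_subproof F).

Definition Lspace_zero : E := Lspace_of 0.
Definition Lspace_opp f : E := Lspace_of (- Lspace_repr f).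
Definition Lspace_add f g : E := Lspace_of (Lspace_repr f + Lspace_repr g).
Definition Lspace_scale (a : R) f : E := Lspace_of (a *: Lspace_repr f).
Definition Lspace_norm f : R := fine 'N[mu]_p[EFin \o f]%E.
Definition Lspace_le f g : bool := `[< \forall x \ae mu, f x <= g x >].
(* max (a, b) = (a + b + |a - b|) / 2 and min (a, b) = (a + b - |a - b|) / 2 *)
Definition Lspace_join f g : E :=
  let F := Lspace_repr f in let G := Lspace_repr g in
  Lspace_of (2^-1 *: (F + G + Lfun_abs (F - G))).
Definition Lspace_meet f g : E :=
  let F := Lspace_repr f in let G := Lspace_repr g in
  Lspace_of (2^-1 *: (F + G - Lfun_abs (F - G))).

Lemma Lspace_zeroE : \forall x \ae mu, Lspace_zero x = 0.
Proof. by apply: filterS (Lspace_ofE 0) => x /(_ I) ->. Qed.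

Lemma Lspace_oppE f : \forall x \ae mu, Lspace_opp f x = - f x.
Proof. by apply: filterS (Lspace_ofE (- Lspace_repr f)) => x /(_ I) ->. Qed.

Lemma Lspace_addE f g : \forall x \ae mu, Lspace_add f g x = f x + g x.
Proof.
by apply: filterS (Lspace_ofE (Lspace_repr f + Lspace_repr g)) => x /(_ I) ->.
Qed.

Lemma Lspace_scaleE a f : \forall x \ae mu, Lspace_scale a f x = a * f x.
Proof. by apply: filterS (Lspace_ofE (a *: Lspace_repr f)) => x /(_ I) ->. Qed.

Lemma Lspace_joinE f g :
  \forall x \ae mu, Lspace_join f g x = Num.max (f x) (g x).
Proof.
set F := Lspace_repr f; set G := Lspace_repr g.
apply: filterS (Lspace_ofE (2^-1 *: (F + G + Lfun_abs (F - G)))) => x /(_ I) ->.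
by rewrite maxr_absE mulrC.
Qed.

Lemma Lspace_meetE f g :
  \forall x \ae mu, Lspace_meet f g x = Num.min (f x) (g x).
Proof.
set F := Lspace_repr f; set G := Lspace_repr g.
apply: filterS (Lspace_ofE (2^-1 *: (F + G - Lfun_abs (F - G)))) => x /(_ I) ->.
by rewrite minr_absE mulrC.
Qed.

Lemma Lspace_eq f g : (\forall x \ae mu, f x = g x) -> f = g.
Proof. by move=> fg; apply/LspaceP; apply: filterS fg. Qed.

HB.instance Definition _ := gen_eqMixin E.
HB.instance Definition _ := gen_choiceMixin E.

Let addA : associative Lspace_add.
Proof.
move=> f g h; apply: Lspace_eq; near=> x.
rewrite (near (Lspace_addE f (Lspace_add g h)) x)// (near (Lspace_addE g h) x)//.
rewrite (near (Lspace_addE (Lspace_add f g) h) x)// (near (Lspace_addE f g) x)//.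
by rewrite addrA.
Unshelve. all: by end_near. Qed.

Let addC : commutative Lspace_add.
Proof.
move=> f g; apply: Lspace_eq; near=> x.
rewrite (near (Lspace_addE f g) x)// (near (Lspace_addE g f) x)//.
by rewrite addrC.
Unshelve. all: by end_near. Qed.

Let add0 : left_id Lspace_zero Lspace_add.
Proof.
move=> f; apply: Lspace_eq; near=> x.
rewrite (near (Lspace_addE Lspace_zero f) x)// (near Lspace_zeroE x)//.
by rewrite add0r.
Unshelve. all: by end_near. Qed.

Let addN : left_inverse Lspace_zero Lspace_opp Lspace_add.
Proof.
move=> f; apply: Lspace_eq; near=> x.
rewrite (near (Lspace_addE (Lspace_opp f) f) x)// (near Lspace_zeroE x)//.
by rewrite (near (Lspace_oppE f) x)// addNr.
Unshelve. all: by end_near. Qed.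

HB.instance Definition _ := GRing.isZmodule.Build E addA addC add0 addN.

Let scaleA a b f : Lspace_scale a (Lspace_scale b f) = Lspace_scale (a * b) f.
Proof.
apply: Lspace_eq; near=> x.
rewrite (near (Lspace_scaleE a (Lspace_scale b f)) x)//.
rewrite (near (Lspace_scaleE b f) x)// (near (Lspace_scaleE (a * b) f) x)//.
by rewrite mulrA.
Unshelve. all: by end_near. Qed.

Let scale1 : left_id 1 Lspace_scale.
Proof.
move=> f; apply: Lspace_eq; near=> x.
by rewrite (near (Lspace_scaleE 1 f) x)// mul1r.
Unshelve. all: by end_near. Qed.

Let scaleDr : right_distributive Lspace_scale +%R.
Proof.
move=> a f g; apply: Lspace_eq; near=> x.
rewrite (near (Lspace_scaleE a (f + g)) x)// (near (Lspace_addE f g) x)//.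
rewrite (near (Lspace_addE (Lspace_scale a f) (Lspace_scale a g)) x)//.
rewrite (near (Lspace_scaleE a f) x)// (near (Lspace_scaleE a g) x)//.
by rewrite mulrDr.
Unshelve. all: by end_near. Qed.

Let scaleDl f : {morph Lspace_scale^~ f : a b / a + b}.
Proof.
move=> a b; apply: Lspace_eq; near=> x.
rewrite (near (Lspace_scaleE (a + b) f) x)//.
rewrite (near (Lspace_addE (Lspace_scale a f) (Lspace_scale b f)) x)//.
rewrite (near (Lspace_scaleE a f) x)// (near (Lspace_scaleE b f) x)//.
by rewrite mulrDl.
Unshelve. all: by end_near. Qed.

HB.instance Definition _ :=
  GRing.Zmodule_isLmodule.Build R E scaleA scale1 scaleDr scaleDl.

Lemma Lspace_norm_ofE F : Lspace_norm (Lspace_of F) = fine 'N[mu]_p[EFin \o F]%E.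
Proof.
by congr fine; apply: ae_eq_Lnorm; [exact: measurable_Lspace| |exact: Lspace_ofE].
Qed.

Let normD f g : Lspace_norm (f + g) <= Lspace_norm f + Lspace_norm g.
Proof.
by rewrite Lspace_norm_ofE; exact: (ler_LnormD (Lspace_repr f) (Lspace_repr g)).
Qed.

Let normZ (a : R) f : Lspace_norm (a *: f) = `|a| * Lspace_norm f.
Proof.
apply/EFin_inj; rewrite Lspace_norm_ofE EFinM.
rewrite (finite_norm_fine (a *: Lspace_repr f)) LnormZ.
by rewrite -(finite_norm_fine (Lspace_repr f)).
Qed.

Let norm_eq0 f : Lspace_norm f = 0 -> f = 0.
Proof.
move=> /(fine_Lnormr_eq0 (f := Lspace_repr f)) f0; apply: Lspace_eq.
near=> x; rewrite (near Lspace_zeroE x)//.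
by have -> : f x = 0 by apply: (near f0 x).
Unshelve. all: by end_near. Qed.

HB.instance Definition _ := Lmodule_isNormed.Build R E normD normZ norm_eq0.

Let le_refl : reflexive Lspace_le.
Proof. by move=> f; apply/asboolP; exact: aeW. Qed.

Let le_anti : antisymmetric Lspace_le.
Proof.
move=> f g /andP[/asboolP fg /asboolP gf]; apply: Lspace_eq.
by apply: filterS2 fg gf => x fg gf; apply/le_anti/andP.
Qed.

Let le_trans : transitive Lspace_le.
Proof.
move=> g f h /asboolP fg /asboolP gh; apply/asboolP.
by apply: filterS2 fg gh => x; exact: le_trans.
Qed.

HB.instance Definition _ := Order.isPOrder.Build ring_display E
  (fun _ _ => erefl) le_refl le_anti le_trans.

Let meetP f g h : (f <= Lspace_meet g h) = (f <= g) && (f <= h).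
Proof.
apply/asboolP/andP => [fgh|[/asboolP fg /asboolP fh]].
  split; apply/asboolP; apply: filterS2 fgh (Lspace_meetE g h) => x.
    by move=> /[swap] ->; rewrite le_min => /andP[].
  by move=> /[swap] ->; rewrite le_min => /andP[].
by apply: filterS3 fg fh (Lspace_meetE g h) => x ? ? ->; rewrite le_min; apply/andP.
Qed.

Let joinP f g h : (Lspace_join f g <= h) = (f <= h) && (g <= h).
Proof.
apply/asboolP/andP => [fgh|[/asboolP fg /asboolP fh]].
  split; apply/asboolP; apply: filterS2 fgh (Lspace_joinE f g) => x.
    by move=> /[swap] ->; rewrite ge_max => /andP[].
  by move=> /[swap] ->; rewrite ge_max => /andP[].
by apply: filterS3 fg fh (Lspace_joinE f g) => x ? ? ->; rewrite ge_max; apply/andP.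
Qed.

HB.instance Definition _ :=
  Order.POrder_MeetJoin_isLattice.Build ring_display E meetP joinP.

Lemma LspaceD f g : \forall x \ae mu, (f + g) x = f x + g x.
Proof. exact: Lspace_addE. Qed.

Lemma LspaceN f : \forall x \ae mu, (- f) x = - f x.
Proof. exact: Lspace_oppE. Qed.

Lemma LspaceZ a f : \forall x \ae mu, (a *: f) x = a * f x.
Proof. exact: Lspace_scaleE. Qed.

Lemma Lspace_normE f : `|f| = fine 'N[mu]_p[EFin \o f]%E.
Proof. by []. Qed.

Lemma Lspace_leP f g : reflect (\forall x \ae mu, f x <= g x) (f <= g).
Proof. exact: asboolP. Qed.

(* The modulus of the vector lattice; `|f| is the norm, a real number. *)
Definition Lspace_abs f : E := Order.join f (- f).

Lemma Lspace_absE f : \forall x \ae mu, Lspace_abs f x = `|f x|.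
Proof.
near=> x; rewrite (near (Lspace_joinE f (- f)) x)// (near (LspaceN f) x)//.
by rewrite maxrN.
Unshelve. all: by end_near. Qed.

(* The coercion of f to a function picks one fixed element of the class f. *)
Definition is_representative f (g : T -> R) : Prop :=
  measurable_fun [set: T] g /\ g = f %[ae mu].

End LspaceQuotient.

(* Families indexed by [0, +oo) are functions on R whose values at negative
   arguments are irrelevant. *)
Definition C0_semigroup (R : realType) (E : normedModType R)
    (T : R -> E -> E) : Prop :=
  [/\ forall t : R, 0 <= t -> linear (T t) /\ continuous (T t),
      forall x, T 0 x = x,
      forall (s t : R) x, 0 <= s -> 0 <= t -> T (s + t) x = T s (T t x) &
      forall x, T t x @[t --> 0^'+] --> x].

Definition positive_semigroup (R : realType) (E : porderZmodType)
    (T : R -> E -> E) : Prop :=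
  forall (t : R) (x : E), 0 <= t -> 0 <= x -> 0 <= T t x.

Definition ru_continuous d (Omega : measurableType d) (R : realType)
    (mu : {measure set Omega -> \bar R}) (p : \bar R) (p1 : (1 <= p)%E)
    (T : R -> LspaceType mu p1 -> LspaceType mu p1) : Prop :=
  forall x, exists2 u : LspaceType mu p1, 0 <= u &
    forall eps : R, 0 < eps -> exists2 t0 : R, 0 < t0 &
      forall t : R, 0 < t <= t0 -> Lspace_abs (T t x - x) <= eps *: u.

(* Main.v *)
(* Relative uniform continuity gives, for each n, some t_n > 0 such that for each
   fixed t > 0 the countably many bounds |T(t)f - f| <= u / (n + 1) with
   t <= t_n hold off a single null set.  The representatives for different t
   are chosen independently, so T(t)f may be replaced by f on that null set,
   which makes the bounds hold everywhere. *)
Require Import Defs.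
From mathcomp Require Import all_boot all_order all_algebra.
From mathcomp Require Import all_classical all_reals all_analysis.

Set Implicit Arguments.
Unset Strict Implicit.
Unset Printing Implicit Defensive.

Import Order.TTheory GRing.Theory Num.Theory.
Import numFieldNormedType.Exports.

Local Open Scope classical_set_scope.
Local Open Scope ring_scope.

(** The exceptional set of [P] lies in a measurable null set [N]. Taking [h] on [N] and [g]
    elsewhere preserves measurability and the class of [g]. *)
Lemma ae_modification d (Omega : measurableType d) (R : realType)
    (mu : {measure set Omega -> \bar R}) (g h : Omega -> R)
    (P : Omega -> Prop) :
  measurable_fun [set: Omega] g -> measurable_fun [set: Omega] h ->
  (\forall x \ae mu, P x) ->
  exists k : Omega -> R,
    [/\ measurable_fun [set: Omega] k, k = g %[ae mu] &
        forall x, k x = h x \/ P x /\ k x = g x].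
Proof.
move=> mg mh [N [mN N0 PN]].
exists (fun x => if x \in N then h x else g x); split.
- apply: measurable_fun_ifT => //.
  by apply: (measurable_fun_bool true); rewrite preimage_mem_true setTI.
- exists N; split=> // x /= Hx; apply: contrapT => Nx; apply: Hx => _.
  by rewrite memNset.
- move=> x; case: ifPn => [_|/negP Nx]; [by left|right; split=> //].
  by apply: contrapT => Px; apply: Nx; rewrite inE; exact: PN.
Qed.

Theorem corollary5p3 (R : realType) (d : measure_display)
    (Omega : measurableType d) (mu : {sigma_finite_measure set Omega -> \bar R})
    (p : R) (p1 : (1 <= p%:E)%E)
    (T : R -> LspaceType mu p1 -> LspaceType mu p1)
    (T_C0 : C0_semigroup T) (T_pos : positive_semigroup T)
    (T_ruc : ru_continuous T) (f : LspaceType mu p1) :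
  exists (fhat : Omega -> R) (Tfhat : R -> Omega -> R),
    [/\ is_representative f fhat,
        forall t : R, 0 < t -> is_representative (T t f) (Tfhat t) &
        forall omega, Tfhat t omega @[t --> 0^'+] --> fhat omega].
Proof.
have [u u0 Tu] := T_ruc f.
have t0_ex (n : nat) : exists t0 : R, 0 < t0 /\
    forall t, 0 < t <= t0 -> Lspace_abs (T t f - f) <= n.+1%:R^-1 *: u.
  have [|t0 t0_gt0 Tt0] := Tu n.+1%:R^-1; first by rewrite invr_gt0.
  by exists t0.
have [t0 t0P] := choice t0_ex.
(* The guard [0 < t] sits under the existential so that [choice] yields a family on all of [R]; [f]
   is a dummy value for [t <= 0]. The bound uses [|u x|] because [u] is nonnegative only almost
   everywhere, while the bound must hold at every [x], including those where [g x = f x]. *)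
have Tfhat_ex (t : R) : exists g : Omega -> R, 0 < t ->
    is_representative (T t f) g /\
    forall n x, t <= t0 n -> `|g x - f x| <= n.+1%:R^-1 * `|u x|.
  have [t_gt0|] := ltP 0 t; last by move=> _; exists f.
  have ae_bound : \forall x \ae mu, forall n, t <= t0 n ->
      `|T t f x - f x| <= n.+1%:R^-1 * `|u x|.
    apply/ae_foralln => n.
    have [tn|_] := leP t (t0 n); last exact: aeW.
    have /Lspace_leP Tfu : Lspace_abs (T t f - f) <= n.+1%:R^-1 *: u.
      by apply: (t0P n).2; rewrite t_gt0.
    near=> x => _.
    have := near Tfu x; rewrite (near (Lspace_absE (T t f - f)) x)//.
    rewrite (near (LspaceD (T t f) (- f)) x)// (near (LspaceN f) x)//.
    rewrite (near (LspaceZ n.+1%:R^-1 u) x)// => /(_ _)/le_trans; apply => //.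
    by rewrite ler_wpM2l ?ler_norm// invr_ge0.
  have [g [mg gTf gP]] := ae_modification (measurable_Lspace (T t f))
    (measurable_Lspace f) ae_bound.
  exists g => _; split=> // n x tn.
  have [->|[Px ->]] := gP x; last exact: Px.
  by rewrite subrr normr0 mulr_ge0// invr_ge0.
have [Tfhat TfhatP] := choice Tfhat_ex.
exists f, Tfhat; split.
- by split; [exact: measurable_Lspace|exact: ae_eq_refl].
- by move=> t /TfhatP[].
- move=> omega; apply/cvgrPdist_le => eps eps_gt0.
  (* Chosen so that [|u omega| / eps < n + 1], hence [|u omega| / (n + 1) <= eps]. The index may
     depend on [omega], since only pointwise convergence is claimed. *)
  pose n := Num.truncn (`|u omega| / eps).
  near=> t; rewrite distrC.
  have t_gt0 : 0 < t by [].
  have [_ /(_ n omega)] := TfhatP t t_gt0.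
  have tn : t <= t0 n by near: t; apply: nbhs_right_le; have [] := t0P n.
  move=> /(_ tn)/le_trans; apply.
  rewrite mulrC ler_pdivrMr// mulrC -ler_pdivrMr//; exact/ltW/truncnS_gt.
Unshelve. all: by end_near. Qed.
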